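(* Let $(A,+)$ be a subsemigroup of the additive semigroup $(\mathbb{R},+)$ with $0\in A$, and let $I$ be an arbitrary interval of reals. Then the category $\overrightarrow{\mathbf{M}}_{\{0\}\cup(I\cap A)}$ has the Ramsey property.
   Context: A linearly ordered metric space is $(M,d,<)$ with $d:M^2\to\mathbb{R}$ a metric and $<$ a linear order on $M$; embeddings are injections preserving distances and preserving and reflecting the order. $\mathrm{spec}(\mathcal{M})=\{d(x,y):x,y\in M\}$. For a set $S$ of nonnegative reals, $\overrightarrow{\mathbf{M}}_S$ is the category of finite linearly ordered metric spaces $\mathcal{M}$ with $\mathrm{spec}(\mathcal{M})\subseteq S$, with embeddings as morphisms. A category has the Ramsey property if for every $k\ge2$ and all objects $\mathcal{A},\mathcal{B}$ with $\hom(\mathcal{A},\mathcal{B})\ne\varnothing$ there is an object $\mathcal{C}$ such that for every partition $\hom(\mathcal{A},\mathcal{C})=\Sigma_1\cup\dots\cup\Sigma_k$ into pairwise disjoint sets there are $i$ and $w\in\hom(\mathcal{B},\mathcal{C})$ with $w\cdot\hom(\mathcal{A},\mathcal{B})\subseteq\Sigma_i$. *)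

(* Defs.v *)
From Stdlib Require Import Reals FinFun.
Open Scope R_scope.

Record LOMS : Type := {
  pt : Type;
  pt_finite : Finite pt;
  dist : pt -> pt -> R;
  olt : pt -> pt -> Prop;
  dist_zero : forall x y, dist x y = 0 <-> x = y;
  dist_sym : forall x y, dist x y = dist y x;
  dist_tri : forall x y z, dist x z <= dist x y + dist y z;
  olt_irrefl : forall x, ~ olt x x;
  olt_trans : forall x y z, olt x y -> olt y z -> olt x z;
  olt_total : forall x y, x <> y -> olt x y \/ olt y x
}.

Definition spec_in (S : R -> Prop) (M : LOMS) : Prop :=
  forall x y : pt M, S (dist M x y).

Definition is_emb (M N : LOMS) (f : pt M -> pt N) : Prop :=
  (forall x y, f x = f y -> x = y) /\
  (forall x y, dist N (f x) (f y) = dist M x y) /\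
  (forall x y, olt M x y <-> olt N (f x) (f y)).

(* Ramsey property of the category of finite LOMS with spectrum in S.
   A partition of hom(A,C) into k pairwise disjoint classes is encoded as a
   colouring chi assigning to each embedding A -> C a colour in {0,...,k-1}. *)
Definition ramsey_property (S : R -> Prop) : Prop :=
  forall (k : nat), (2 <= k)%nat ->
  forall A B : LOMS, spec_in S A -> spec_in S B ->
  (exists f : pt A -> pt B, is_emb A B f) ->
  exists C : LOMS, spec_in S C /\
    forall chi : (pt A -> pt C) -> nat,
      (forall f, is_emb A C f -> (chi f < k)%nat) ->
      exists (i : nat) (w : pt B -> pt C),
        (i < k)%nat /\ is_emb B C w /\
        forall u : pt A -> pt B, is_emb A B u -> chi (fun x => w (u x)) = i.

(* An interval of reals: a (possibly empty, degenerate or unbounded) convex subset. *)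
Definition is_interval (I : R -> Prop) : Prop :=
  forall x y z, I x -> I z -> x <= y -> y <= z -> I y.

Definition is_subsemigroup_with_0 (A : R -> Prop) : Prop :=
  A 0 /\ forall x y, A x -> A y -> A (x + y).

(* Main.v *)
From mathcomp Require Import all_boot zify boolp.
From Stdlib Require Import Reals Lra.
Require Import Defs.
Set Implicit Arguments.
Unset Strict Implicit.
Unset Printing Implicit Defensive.
Local Open Scope nat_scope.

(** Given [B], let [S] be the finite set of all sums of distances of [B] that
    do not exceed the diameter; it lies in [{0} U (I n A)] and is closed under
    addition truncated at the diameter.  For a space [M] with distances in
    [S], the 1-Lipschitz functions [M -> S] are ordered colexicographically by
    their hypographs, with positions compared by level first and by point
    second.  Evaluating these functions along a word which is a rigid
    surjection from [N] onto their set embeds [M] into [S^N], where [S^N]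
    carries the supremum distance rounded up to [S] and the reversed
    lexicographic order.  The pointwise least Lipschitz extension is monotone
    for the order on functions, so restricting the functions of [B] along an
    embedding [A -> B] is itself a rigid surjection.  The Ramsey property of
    metric spaces thus follows from the dual Ramsey theorem, which is the case
    of the empty alphabet of the Graham-Rothschild theorem; the latter is
    proved by induction on the number of parameters from the Hales-Jewett
    theorem, itself obtained by Shelah's argument. *)

(** * The Graham-Rothschild theorem *)

(* [rg a w b]: [w] has constants [0 .. a-1] and parameters [a .. b-1], every
   parameter occurs, and first occurrences of parameters are in increasing
   order. *)
Fixpoint rg (a : nat) (w : seq nat) (b : nat) : bool :=
  if w is c :: w' then
    if c < a then rg a w' b else (c == a) && rg a.+1 w' b
  else a == b.

(** An [n]-parameter word of length [N] over [a] letters; for [a = 0] it is a rigid surjection from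
    [N] onto [n], and [comp] is composition of surjections. *)
Definition pword (a N n : nat) (w : seq nat) : bool :=
  (size w == N) && rg a w (a + n).

Definition sub (a : nat) (V : seq nat) (c : nat) : nat :=
  if c < a then c else nth 0 V (c - a).

Definition comp (a : nat) (W V : seq nat) : seq nat := map (sub a V) W.
Arguments comp : simpl never.

(** Renumbers the parameters so that the letter [a] becomes free, either as an extra constant or as
    a new first parameter. *)
Definition shift (a c : nat) : nat := if c < a then c else c.+1.

Lemma rg_leq a w b : rg a w b -> a <= b.
Proof.
elim: w a => [|c w IH] a /=; first by move/eqP->.
by case: ifP => _; [exact: IH | case/andP=> _ /IH /ltnW].
Qed.

Lemma rg_size a w b : rg a w b -> b <= a + size w.
Proof.
elim: w a => [|c w IH] a /=; first by move/eqP->; rewrite addn0.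
by case: ifP => _; [move/IH | case/andP=> _ /IH]; lia.
Qed.

Lemma rg_lt a w b c : rg a w b -> c \in w -> c < b.
Proof.
elim: w a => [|x w IH] a //=; rewrite inE; case: ifP => xa.
  by move=> r /orP[/eqP->|/(IH _ r)//]; apply: leq_trans xa (rg_leq r).
by case/andP=> /eqP-> r /orP[/eqP->|/(IH _ r)//]; apply: rg_leq r.
Qed.

Lemma rg_const a w : rg a w a = all (fun c => c < a) w.
Proof.
elim: w => [|c w IH] /=; first exact: eqxx.
case: ifP => //= _; apply/negP => /andP[_ /rg_leq]; by rewrite ltnn.
Qed.

Lemma rg_cat a b c w1 w2 : rg a w1 b -> rg b w2 c -> rg a (w1 ++ w2) c.
Proof.
elim: w1 a => [|x w IH] a /=; first by move/eqP->.
by case: ifP => _; [exact: IH | case/andP=> -> /IH].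
Qed.

Lemma rg_iota a n : rg a (iota a n) (a + n).
Proof. by elim: n a => [|n IH] a /=; rewrite ?addn0 // ltnn eqxx /= addnS -addSn. Qed.

Lemma rg_shift a b e w : a <= b -> rg b w e -> rg b.+1 (map (shift a) w) e.+1.
Proof.
elim: w b => [|c w IH] b ab /=; first by rewrite eqSS.
case: ifP => cb; rewrite /shift.
  by move=> r; case: (ltnP c a) => ca; rewrite ifT ?IH //; lia.
case/andP=> /eqP-> r; rewrite [b < a]ltnNge ab /= ltnn eqxx /=; apply: IH => //; lia.
Qed.

(* After [j] parameters of [W] have been read, the composite has read
   [take j V] and is in state [b']. *)
Lemma rg_map_sub a j b' b V W :
  rg (a + j) W (a + size V) -> rg a (take j V) b' -> rg b' (drop j V) b ->
  rg b' (map (sub a V) W) b.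
Proof.
elim: W j b' => [|c W IH] j b' /=.
  by move=> /eqP/addnI-> _; rewrite drop_size.
case: (ltnP c (a + j)) => cj.
  move=> rW rt rd; have ab' := rg_leq rt.
  suff -> : sub a V c < b' by exact: IH rW rt rd.
  rewrite /sub; case: (ltnP c a) => ca; first by lia.
  have jV : j <= size V by have := rg_leq rW; lia.
  apply: (rg_lt rt); rewrite -(nth_take 0 (n0 := j)); last by lia.
  by apply: mem_nth; rewrite size_takel ?ltn_subLR.
case/andP=> /eqP-> rW rt rd.
have jV : j < size V by have := rg_leq rW; lia.
have -> : sub a V (a + j) = nth 0 V j by rewrite /sub ifN ?addKn //; lia.
rewrite (drop_nth 0 jV) /= in rd; rewrite -addnS in rW.
have rt' b'' : rg b' [:: nth 0 V j] b'' -> rg a (take j.+1 V) b''.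
  by rewrite (take_nth 0 jV) -cats1; apply: rg_cat.
move: rd; case: ifP => xb.
  by move=> rd; apply: IH rW _ rd; apply: rt'; rewrite /= xb eqxx.
case/andP=> /eqP xE rd; rewrite xE eqxx /=; apply: IH rW _ rd.
by apply: rt'; rewrite /= xE ltnn !eqxx.
Qed.

Lemma pword_comp a N n k W V : pword a N n W -> pword a n k V -> pword a N k (comp a W V).
Proof.
case/andP=> /eqP sW rW /andP[/eqP sV rV]; rewrite /pword size_map sW eqxx /=.
apply: (@rg_map_sub a 0 a); rewrite ?take0 ?drop0 ?addn0 ?sV //=.
Qed.

Lemma pword_const a n V : pword a n 0 V = (size V == n) && all (fun c => c < a) V.
Proof. by rewrite /pword addn0 rg_const. Qed.

Lemma comp_assoc a N n W V U :
  pword a N n W -> size V = n -> comp a (comp a W V) U = comp a W (comp a V U).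
Proof.
case/andP=> _ rW sV; rewrite /comp -map_comp; apply/eq_in_map => c cW /=.
have := rg_lt rW cW => cn; rewrite [in LHS]/sub [in RHS]/sub.
case: (ltnP c a) => ca; first by rewrite ca.
by rewrite (nth_map 0) ?sV //; lia.
Qed.

Lemma sub_shift a c V x : sub a (c :: V) (shift a x) = sub a V x.
Proof.
rewrite /sub /shift; case: (ltnP x a) => xa; first by rewrite xa.
by rewrite ifN ?subSn //; lia.
Qed.

Lemma sub_shiftS a V x : sub a.+1 V (shift a x) = sub a V x.
Proof.
rewrite /sub /shift; case: (ltnP x a) => xa; first by rewrite ifT //; lia.
by rewrite ifN ?subSS //; lia.
Qed.

(** A leading [a] in the substituted word sends the first parameter to itself, so that parameter may
    as well be counted as a constant. *)
Lemma comp_cons a V W : comp a W (a :: V) = comp a.+1 W V.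
Proof.
apply: eq_map => x; rewrite /sub; case: (ltngtP x a) => xa.
- by rewrite ifT //; lia.
- by rewrite ifN ?subnS; [case: (x - a) (subn_gt0 a x) => [|m] //=; lia | lia].
- by rewrite xa subnn ltnSn.
Qed.

Lemma comp_shift a c V W : comp a (map (shift a) W) (c :: V) = comp a W V.
Proof. by rewrite /comp -map_comp; apply: eq_map => x /=; rewrite sub_shift. Qed.

Lemma comp_shiftS a V W : comp a.+1 (map (shift a) W) V = comp a W V.
Proof. by rewrite /comp -map_comp; apply: eq_map => x /=; rewrite sub_shiftS. Qed.

(** * The Hales-Jewett theorem *)

Lemma word_tuple a n V : size V = n -> all (fun c => c < a) V ->
  exists t : n.-tuple 'I_a, map val t = V.
Proof.
move=> sV; subst n; elim: V => [|c V IH] /=; first by exists [tuple].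
case/andP=> ca /IH[t tV]; exists (cons_tuple (Ordinal ca) t) => /=.
by rewrite tV.
Qed.

Lemma pigeonhole_pair (K : finType) (f : nat -> K) :
  exists i j, [/\ i < j, j <= #|K| & f i = f j].
Proof.
have [/injectiveP inj|/injectivePn[x [y xy fxy]]] :=
    boolP (injectiveb (fun i : 'I_#|K|.+1 => f i)).
  by have := leq_card _ inj; rewrite card_ord ltnn.
have := ltn_ord x; have := ltn_ord y.
by case: (ltngtP x y) => [lt|lt|/val_inj e] ly lx; [exists x, y|exists y, x|rewrite e eqxx in xy].
Qed.

Lemma sub_lt a V x : x < a -> sub a V x = x.
Proof. by rewrite /sub => ->. Qed.

(** Among the [#|K| + 1] words consisting of [i] letters [q] followed by letters [p], two have the
    same colour. Placing the parameter where these two differ gives [w]. *)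
Lemma shelah_block a p q (K : finType) : p < a -> q < a ->
  forall chi : seq nat -> K, exists w,
    pword a #|K| 1 w /\ chi (comp a w [:: p]) = chi (comp a w [:: q]).
Proof.
move=> pa qa chi.
have [i [j [ij jM e]]] := pigeonhole_pair (fun i => chi (nseq i q ++ nseq (#|K| - i) p)).
exists (nseq i q ++ nseq (j - i) a ++ nseq (#|K| - j) p); split.
  apply/andP; split; first by rewrite !size_cat !size_nseq; lia.
  have cst b x m : x < b -> rg b (nseq m x) b.
    by rewrite rg_const all_nseq => ->; rewrite orbT.
  apply: (rg_cat (cst _ _ _ qa)); apply: (rg_cat (b := a.+1)); last first.
    by rewrite addn1; apply: cst; lia.
  by case: (j - i) (subn_gt0 i j) => [|m]; [lia | move=> _ /=; rewrite ltnn eqxx cst].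
have subE x : sub a [:: x] a = x by rewrite /sub ltnn subnn.
rewrite /comp !map_cat !map_nseq !(sub_lt _ pa) !(sub_lt _ qa) !subE.
rewrite -nseqD catA -nseqD subnKC 1?ltnW // -e; congr (chi (_ ++ nseq _ _)); lia.
Qed.

(* One block of Shelah's proof of Hales-Jewett per parameter. *)
Lemma shelah_insensitive a p q n : p < a -> q < a ->
  forall K : finType, exists N, forall chi : seq nat -> K,
  exists2 W, pword a N n W & forall V, pword a n 0 V ->
    chi (comp a W V) = chi (comp a W (map (fun c => if c == q then p else c) V)).
Proof.
move=> pa qa; elim: n => [|n IH] K.
  by exists 0 => chi; exists [::]; rewrite ?/pword ?addn0 /= ?eqxx.
(* The colour of a tail records the colours for all letters in the first block, and the colour of a
   first block (in [K2]) records those for all constant tails. Hence [N'] is fixed before the length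
   of the block. *)
have [N' IHN] := IH {ffun 'I_a -> K}.
pose K2 : finType := {ffun N'.-tuple 'I_a -> K}.
exists (#|K2| + N') => chi.
have [w0 [w0P e0]] := @shelah_block a p q K2 pa qa
   (fun w => [ffun t : N'.-tuple 'I_a => chi (w ++ map val t)]).
have [W' W'P e'] := IHN (fun v => [ffun c : 'I_a => chi (comp a w0 [:: val c] ++ v)]).
have comp_cat c V : comp a (w0 ++ map (shift a) W') (c :: V) = comp a w0 [:: c] ++ comp a W' V.
  rewrite /comp map_cat -!/(comp _ _ _) comp_shift; congr (_ ++ _).
  apply/eq_in_map => x xw; case/andP: w0P => _ /rg_lt/(_ xw).
  by rewrite /sub addn1 ltnS => xa; case: ltnP => // ax; have -> : x - a = 0 by lia.
exists (w0 ++ map (shift a) W').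
  case/andP: w0P => /eqP s0 r0; case/andP: W'P => /eqP s' r'.
  rewrite /pword size_cat size_map s0 s' eqxx /=; apply: rg_cat r0 _.
  by rewrite addn1 addnS; apply: rg_shift.
move=> [|c V]; rewrite pword_const // => /andP[sV /= /andP[ca aV]].
have VP : pword a n 0 V by rewrite pword_const -eqSS sV.
rewrite !comp_cat.
have := congr1 (fun f : {ffun 'I_a -> K} => f (Ordinal ca)) (e' V VP); rewrite !ffunE /= => ->.
(* Only a first letter [q] is left to change. The tail is a constant word by now, so the choice of
   [w0] applies to it. *)
case: eqP => // ->; set V' := map _ V.
have V'P : pword a n 0 V'.
  rewrite pword_const size_map -eqSS sV /=; apply/allP => _ /mapP[x xV ->].
  by case: ifP => // _; apply: (allP aV).
have : pword a N' 0 (comp a W' V') by apply: pword_comp W'P V'P.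
rewrite pword_const => /andP[/eqP sz /(word_tuple sz)[t <-]].
by have := congr1 (fun f : K2 => f t) e0; rewrite !ffunE.
Qed.

(** Induction on the alphabet: once the colour does not distinguish the last two letters, they can
    be identified, and the claim for one letter less applies. With at most one letter there is at
    most one constant word. *)
Lemma hales_jewett a n (K : finType) : exists N, forall chi : seq nat -> K,
  exists2 W, pword a N n W & forall V V', pword a n 0 V -> pword a n 0 V' ->
    chi (comp a W V) = chi (comp a W V').
Proof.
case: a => [|a].
  exists n => chi; exists (iota 0 n); first by rewrite /pword size_iota eqxx rg_iota.
  by move=> [|? ?] [|? ?]; rewrite !pword_const //= !andbF.
elim: a => [|a [n' IH]].
  exists n => chi; exists (iota 1 n); first by rewrite /pword size_iota eqxx rg_iota.
  have zero V : pword 1 n 0 V -> V = nseq n 0.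
    rewrite pword_const => /andP[/eqP <-]; elim: V => //= c V IH /andP[c0 /IH <-].
    by congr (_ :: _); lia.
  by move=> V V' /zero-> /zero->.
have [N HN] := @shelah_insensitive a.+2 a a.+1 n' (leqW (leqnn _)) (leqnn _) K.
exists N => chi; have [W WP insW] := HN chi.
have [W' W'P monoW'] := IH (fun V => chi (comp a.+2 W V)).
pose fl c := if c == a.+1 then a else c.
(* [W'] was found over [a.+1] constants; its parameters move up by one to make room for the constant
   [a.+1]. *)
have sW' : pword a.+2 n' n (map (shift a.+1) W').
  case/andP: W'P => /eqP s' r'; rewrite /pword size_map s' eqxx /=.
  by rewrite addSn; apply: rg_shift.
exists (comp a.+2 W (map (shift a.+1) W')); first exact: pword_comp WP sW'.
have key V : pword a.+2 n 0 V ->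
    chi (comp a.+2 (comp a.+2 W (map (shift a.+1) W')) V)
    = chi (comp a.+2 W (comp a.+1 W' (map fl V))) /\ pword a.+1 n 0 (map fl V).
  move=> VP; split; last first.
    move: VP; rewrite !pword_const size_map => /andP[-> /allP aV] /=.
    apply/allP => _ /mapP[x /aV xa ->]; rewrite /fl; case: eqP; lia.
  rewrite (comp_assoc _ WP); last by rewrite size_map; case/andP: W'P => /eqP.
  rewrite insW; last exact: pword_comp sW' VP.
  rewrite comp_shiftS /comp -map_comp -!/(comp _ _ _); congr (chi (comp _ _ _)).
  apply/eq_in_map => x xW /=; case/andP: W'P => _ /rg_lt/(_ xW) xn.
  case/andP: VP => /eqP sV _.
  rewrite /sub; case: ltnP => xa; first by rewrite ifN //; lia.
  by rewrite (nth_map 0) // sV; lia.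
move=> V V' /key[-> VP] /key[-> V'P]; exact: monoW'.
Qed.

(** * Constant prefixes: the letters before the first parameter *)

Fixpoint pre (a : nat) (w : seq nat) : seq nat :=
  if w is c :: w' then if c < a then c :: pre a w' else [::] else [::].

Lemma pre_all a w : all (fun c => c < a) (pre a w).
Proof. by elim: w => //= c w IH; case: ifP => //= ->. Qed.

Lemma size_pre a w : size (pre a w) <= size w.
Proof. by elim: w => //= c w IH; case: ifP. Qed.

Lemma pre_cat a w1 w2 :
  pre a (w1 ++ w2) = if all (fun c => c < a) w1 then w1 ++ pre a w2 else pre a w1.
Proof.
elim: w1 => //= c w IH; case: ifP => //= _; rewrite IH; by case: ifP.
Qed.

Lemma nth_lt_pre a w i : i < size (pre a w) -> nth 0 w i = nth 0 (pre a w) i.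
Proof. by elim: w i => //= c w IH [|i]; case: ifP => //= _ /IH. Qed.

Lemma nth_size_pre a w : size (pre a w) < size w -> a <= nth 0 w (size (pre a w)).
Proof. by elim: w => //= c w IH; case: (ltnP c a) => //= _ /IH. Qed.

Lemma size_pre_eq a w : size (pre a w) = size w -> all (fun c => c < a) w.
Proof.
move=> e; case: (boolP (all _ _)) => //; elim: w e => //= c w IH.
by case: ifP => //= _ [] /IH.
Qed.

Lemma pre_split a w b : a < b -> rg a w b ->
  exists2 q, w = pre a w ++ a :: q & rg a.+1 q b.
Proof.
move=> ab; elim: w => [|c w IH] /=; first by lia.
case: ifP => _; first by move=> /IH[q e r]; exists q => //=; rewrite -e.
by case/andP=> /eqP-> r; exists w.
Qed.

(** Parameters of [W] first occur in increasing order, so the composite stays constant until [W]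
    reaches parameter number [size (pre a V)], and until then only letters of [pre a V] are used.
    The induction needs [j], the number of parameters of [W] met so far. *)
Lemma pre_map_sub a j V V' W :
  pre a V = pre a V' -> size V = size V' -> rg (a + j) W (a + size V) ->
  j <= size (pre a V) -> pre a (map (sub a V) W) = pre a (map (sub a V') W).
Proof.
move=> eV sV; elim: W j => //= c W IH j.
have nthE i : i < size (pre a V) -> nth 0 V i = nth 0 V' i.
  by move=> iV; rewrite (nth_lt_pre iV) eV -nth_lt_pre // -eV.
case: (ltnP c (a + j)) => cj.
  move=> rW jV; have -> : sub a V c = sub a V' c.
    by rewrite /sub; case: (ltnP c a) => ca //; apply: nthE; clear -cj jV ca; lia.
  by rewrite (IH _ rW jV).
case/andP=> /eqP-> {cj c} rW; have jS : j < size V by have := rg_leq rW; lia.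
have subE U : sub a U (a + j) = nth 0 U j by rewrite /sub ifN ?addKn //; lia.
rewrite !subE leq_eqVlt => /orP[/eqP jE|jV].
  have lV : a <= nth 0 V j by rewrite jE nth_size_pre // -jE.
  have lV' : a <= nth 0 V' j by rewrite jE eV nth_size_pre // -eV -jE -sV.
  by rewrite !ltnNge lV lV'.
by rewrite (nthE _ jV) (IH j.+1) // addnS.
Qed.

Lemma pre_comp a N n W V V' : pword a N n W -> size V = n -> size V' = n ->
  pre a V = pre a V' -> pre a (comp a W V) = pre a (comp a W V').
Proof.
case/andP=> _ rW sV sV' eV; apply: (@pre_map_sub a 0) => //; first by rewrite sV.
by rewrite addn0 sV.
Qed.

(** * From [k] to [k.+1] parameters *)

Lemma rg_mem a w b c : rg a w b -> a <= c -> c < b -> c \in w.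
Proof.
elim: w a => [|x w IH] a /=; first by move/eqP->; lia.
rewrite inE; case: ifP => _; first by move=> r ac cb; rewrite (IH _ r ac cb) orbT.
case/andP=> /eqP-> r; rewrite leq_eqVlt => /orP[/eqP->|ac cb]; first by rewrite eqxx.
by rewrite (IH _ r ac cb) orbT.
Qed.

(** Induction on [L] by the first letter of [V]. If it is a parameter, the rest is a [k]-parameter
    word over [a.+1] constants and the hypothesis for [k] applies. If it is a constant, the
    induction hypothesis applies to colours that record all choices of this constant. *)
Lemma tail_homogeneous k :
  (forall a n (K : finType), exists N, forall chi : seq nat -> K,
     exists2 W, pword a N n W & forall V V', pword a n k V -> pword a n k V' ->
       chi (comp a W V) = chi (comp a W V')) ->
  forall a L (K : finType), exists N, forall chi : seq nat -> K,
  exists2 W, pword a N L W & forall V V',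
    pword a L k.+1 V -> pword a L k.+1 V' -> pre a V = pre a V' ->
    chi (comp a W V) = chi (comp a W V').
Proof.
move=> GR a; elim=> [|L IH] K.
  by exists 0 => chi; exists [::]; rewrite ?/pword ?addn0 /= ?eqxx.
have [N2 HN2] := IH {ffun 'I_a -> K}; have [N1 HN1] := GR a.+1 N2 K.
exists N1.+1 => chi.
(* [U] settles the words that start with a parameter; [W'], substituted into [U], settles those that
   start with a constant. *)
have [U UP monoU] := HN1 (fun u => chi (a :: u)).
have [W' W'P tailW'] := HN2 (fun Y => [ffun c : 'I_a => chi (comp a (a :: U) (val c :: Y))]).
have Zs : pword a.+1 N2 L (map (shift a) W').
  by case/andP: W'P => /eqP s r; rewrite /pword size_map s eqxx addSn rg_shift.
have consP b M m X : pword b.+1 M m X -> pword b M.+1 m.+1 (b :: X).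
  by rewrite /pword /= eqSS ltnn eqxx /= addnS addSn.
have UP' := consP _ _ _ _ UP.
exists (comp a (a :: U) (a :: map (shift a) W')); first exact: pword_comp UP' (consP _ _ _ _ Zs).
have assoc V : comp a (comp a (a :: U) (a :: map (shift a) W')) V =
               comp a (a :: U) (comp a (a :: map (shift a) W') V).
  by apply: comp_assoc UP' _; case/andP: Zs => /eqP /= ->.
have sub_a c V : sub a (c :: V) a = c by rewrite /sub ltnn subnn.
have consE c V : comp a (a :: map (shift a) W') (c :: V) = c :: comp a (map (shift a) W') (c :: V).
  by rewrite /comp /= sub_a.
move=> [|c V] [|c' V'] // VP V'P; rewrite !assoc /=.
case: (ltnP c a) => ca.
  case: (ltnP c' a) => // _ [cc' eV']; rewrite -cc' in V'P *.
  rewrite !consE !comp_shift.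
  have tP X : pword a L.+1 k.+1 (c :: X) -> pword a L k.+1 X.
    by rewrite /pword /= ca eqSS.
  have := congr1 (fun f : {ffun 'I_a -> K} => f (Ordinal ca)) (tailW' _ _ (tP _ VP) (tP _ V'P) eV').
  by rewrite !ffunE.
case: (ltnP c' a) => // ca' _.
have tP x X : a <= x -> pword a L.+1 k.+1 (x :: X) -> x = a /\ pword a.+1 L k X.
  move=> ax /andP[] /=; rewrite ltnNge ax /= eqSS => sX /andP[/eqP-> rX].
  by split=> //; rewrite /pword sX addSn -addnS.
have [-> {}VP] := tP _ _ ca VP; have [-> {}V'P] := tP _ _ ca' V'P.
rewrite !consE !comp_cons /comp /= !sub_lt // -!/(comp _ _ _).
by apply: monoU; apply: pword_comp Zs _.
Qed.

(** Induction on [L], adding one last parameter. A prefix filling the first [L] places yields a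
    constant word substituted into [U], and Hales-Jewett gives all of these one colour; shorter
    prefixes fall to the induction hypothesis. *)
Lemma prefix_homogeneous a L (K : finType) : exists N, forall F : seq nat -> K,
  exists2 W, pword a N L W & forall V V', size V = L -> size V' = L ->
    size (pre a V) < L -> size (pre a V) = size (pre a V') ->
    F (pre a (comp a W V)) = F (pre a (comp a W V')).
Proof.
elim: L => [|L [N' IH]].
  by exists 0 => F; exists [::]; rewrite ?/pword ?addn0 /= ?eqxx.
have [N1 HJ] := hales_jewett a N' K.
exists N1.+1 => F; have [U UP monoU] := HJ F.
(* By [pre_comp] the prefix after substitution into [U] depends only on the prefix [p], so padding
   [p] with the parameter [a] gives the right value. *)
pose F' p := F (pre a (comp a U (p ++ nseq (N' - size p) a))).
have [W' W'P homW'] := IH F'.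
have UW := pword_comp UP W'P; set UW' := comp a U W' in UW.
exists (rcons UW' (a + L)).
  case/andP: UW => /eqP s r; rewrite /pword size_rcons s eqxx /= -cats1.
  by apply: rg_cat r _; rewrite /= ltnn eqxx addnS eqxx.
have compE V x : size V = L ->
    comp a (rcons UW' (a + L)) (rcons V x) = rcons (comp a U (comp a W' V)) x.
  move=> sV; rewrite -(comp_assoc _ UP) -/UW'; last by case/andP: W'P => /eqP.
  rewrite /comp map_rcons; congr rcons.
    apply/eq_in_map => y yU; case/andP: UW => _ /rg_lt/(_ yU) yL.
    rewrite /sub; case: ltnP => // ya; rewrite nth_rcons ifT // sV; lia.
  by rewrite /sub ifN ?nth_rcons ?addKn ?sV ?ltnn ?eqxx //; lia.
case/lastP=> [|V x]; first by [].
case/lastP=> [|V' x']; first by [].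
rewrite !size_rcons => -[sV] [sV']; rewrite !compE // -!cats1 !pre_cat.
have [aV|nV] := boolP (all _ V); have [aV'|nV'] := boolP (all _ V').
- move=> lt eq.
  have cst X : size X = L -> all (fun c => c < a) X -> pword a N' 0 (comp a W' X).
    by move=> sX aX; apply: pword_comp W'P _; rewrite pword_const sX eqxx.
  have [cV cV'] := (cst _ sV aV, cst _ sV' aV').
  have allc X : pword a N' 0 X -> all (fun c => c < a) (comp a U X).
    by move=> XP; have := pword_comp UP XP; rewrite pword_const => /andP[].
  have pre1 X y : size X = L -> size (X ++ pre a [:: y]) < L.+1 -> pre a [:: y] = [::].
    by move=> sX; rewrite size_cat sX /=; case: ifP => //= _; lia.
  rewrite !allc // (pre1 V x) // (pre1 V' x') //; last by rewrite -eq.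
  by rewrite !cats0; apply: monoU.
- rewrite size_cat sV => _ e; case/negP: nV'; apply: size_pre_eq.
  by have := size_pre a V'; lia.
- rewrite size_cat sV' => _ e; case/negP: nV; apply: size_pre_eq.
  by have := size_pre a V; lia.
- move=> _ e.
  have lt X : size X = L -> ~~ all (fun c => c < a) X -> size (pre a X) < L.
    move=> <- nX; rewrite ltn_neqAle size_pre andbT; apply: contra nX => /eqP.
    exact: size_pre_eq.
  have nall X : size X = L -> ~~ all (fun c => c < a) X ->
      ~~ all (fun c => c < a) (comp a U (comp a W' X)).
    move=> sX nX; rewrite -(comp_assoc _ UP) -/UW'; last by case/andP: W'P => /eqP.
    have ltX := lt _ sX nX; case/andP: UW => _ rU.
    have mem : a + size (pre a X) \in UW' by apply: (rg_mem rU); lia.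
    apply/allPn; exists (sub a X (a + size (pre a X))); first exact: map_f.
    rewrite /sub ifN ?addKn -?leqNgt ?leq_addr // nth_size_pre //; lia.
  rewrite !ifN ?nall //.
  have F'E X : size X = L -> F (pre a (comp a U (comp a W' X))) = F' (pre a (comp a W' X)).
    move=> sX; rewrite /F'; congr F; case/andP: W'P => /eqP sW' _.
    have := size_pre a (comp a W' X); rewrite size_map sW' => le.
    apply: (pre_comp UP); rewrite ?size_map //; first by rewrite size_cat size_nseq; lia.
    rewrite pre_cat pre_all.
    by case: (N' - _) => [|m] /=; rewrite ?ltnn cats0.
  by rewrite !F'E //; apply: homW' => //; apply: lt.
Qed.

(** Fresh parameters go to the first [m] marked places and the constant [0] everywhere else. A
    constant prefix of a word substituted into it can therefore end only at a marked place. *)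
Fixpoint select (b m : nat) (s : seq bool) : seq nat :=
  match s, m with
  | true :: s', m'.+1 => b :: select b.+1 m' s'
  | _ :: s', _ => 0 :: select b m s'
  | [::], _ => [::]
  end.

Lemma size_select b m s : size (select b m s) = size s.
Proof. by elim: s b m => [|[] s IH] b [|m] //=; rewrite IH. Qed.

Lemma rg_select b m (s : seq bool) : 0 < b -> m <= count idfun s -> rg b (select b m s) (b + m).
Proof.
elim: s b m => [|x s IH] b m b0 /=; first by rewrite leqn0 => /eqP->; rewrite addn0.
case: x m => [] [|m] /= le; rewrite ?b0 ?ltnn ?eqxx /=.
- exact: IH.
- by rewrite addnS -addSn IH.
- exact: IH.
- exact: IH.
Qed.

Lemma nth_select b m s i : 0 < nth 0 (select b m s) i -> nth false s i.
Proof.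
elim: s b m i => [|x s IH] b m [|i] //=; first by case: x; case: m.
by case: x m => [] [|m] /=; apply: IH.
Qed.

Lemma pigeonhole_class (K : finType) n (g : nat -> K) :
  exists c, n <= count idfun (map (fun i => g i == c) (iota 0 (#|K| * n).+1)).
Proof.
pose L := (#|K| * n).+1.
have [c|none] := pickP (fun c => n <= count idfun (map (fun i => g i == c) (iota 0 L))).
  by exists c.
have : \sum_(c : K) count idfun (map (fun i => g i == c) (iota 0 L)) <= \sum_(c : K) n.
  by apply: leq_sum => c _; have := none c; case: leqP => // /ltnW.
rewrite sum_nat_const.
suff -> : \sum_(c : K) count idfun (map (fun i => g i == c) (iota 0 L)) = L by rewrite ltnn.
rewrite -[RHS](size_iota 0); elim: (iota 0 L) => [|i s IH] /=; first by rewrite big1.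
rewrite big_split IH /= (bigD1 (g i)) //= eqxx big1 // => c; by rewrite eq_sym => /negbTE->.
Qed.

(** In the inductive step the colour is first made to depend only on the constant prefix, then only
    on its length. By pigeonhole, enough lengths share one colour, and [select] leaves only those
    lengths possible. *)
Theorem graham_rothschild k a n (K : finType) : exists N, forall chi : seq nat -> K,
  exists2 W, pword a N n W & forall V V', pword a n k V -> pword a n k V' ->
    chi (comp a W V) = chi (comp a W V').
Proof.
elim: k a n K => [|k IH] a n K; first exact: hales_jewett.
have tail := tail_homogeneous IH a; case: (posnP a) => [a0|a0].
  (* Without constants all prefixes are empty, so homogeneity of tails suffices. *)
  have [N HN] := tail n K; exists N => chi; have [W WP eqW] := HN chi.
  by exists W => // V V' VP V'P; apply: eqW => //; rewrite a0; case: (V); case: (V').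
have [NB HB] := prefix_homogeneous a (#|K| * n).+1 K; have [NA HA] := tail NB K.
exists NA => chi; have [WA WAP tailA] := HA chi.
(* A standard word with [k.+1] parameters and constant prefix [p]: its colour represents all words
   with that prefix. *)
pose ext p := p ++ a :: iota a.+1 k ++ nseq (NB - (size p + k).+1) 0.
have [WB WBP homB] := HB (fun p => chi (comp a WA (ext p))).
(* [probe i] has a constant prefix of length exactly [i], so [g i] is the colour belonging to prefix
   length [i]. *)
pose L := (#|K| * n).+1; pose probe i := nseq i 0 ++ nseq (L - i) a.
pose g i := chi (comp a WA (ext (pre a (comp a WB (probe i))))).
have [c cn] := pigeonhole_class n g.
pose s := map (fun i => g i == c) (iota 0 L).
have WCP : pword a L n (select a n s).
  by rewrite /pword size_select size_map size_iota eqxx rg_select.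
exists (comp a WA (comp a WB (select a n s))).
  by apply: pword_comp WAP (pword_comp WBP WCP).
suff mono V : pword a n k.+1 V -> chi (comp a (comp a WA (comp a WB (select a n s))) V) = c.
  by move=> V V' /mono-> /mono->.
move=> VP; have CV := pword_comp WCP VP; have BCV := pword_comp WBP CV.
rewrite (comp_assoc _ WAP); last by case/andP: WBP => /eqP; rewrite size_map.
rewrite (comp_assoc _ WBP); last by case/andP: WCP => /eqP.
set X := comp a (select a n s) V in CV BCV *; set Y := comp a WB X in BCV *.
have lt b w m : rg b w (b + m.+1) -> size (pre b w) < size w.
  move=> r; have [q e _] := pre_split (ltac:(lia) : b < b + m.+1) r.
  by rewrite [in X in _ < X]e size_cat /=; lia.
have extP : pword a NB k.+1 (ext (pre a Y)).
  case/andP: BCV => /eqP sY rY; have [q e rq] := pre_split (ltac:(lia) : a < a + k.+1) rY.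
  have := rg_size rq; have : size Y = size (pre a Y) + (size q).+1 by rewrite [in LHS]e size_cat.
  rewrite sY => szY szq; apply/andP; split.
    rewrite /ext size_cat /= size_cat size_iota size_nseq; lia.
  apply: (rg_cat (b := a)); first by rewrite rg_const pre_all.
  rewrite /= ltnn eqxx /=; apply: rg_cat (rg_iota _ _) _.
  by rewrite addnS -addSn rg_const all_nseq /=; apply/orP; right; lia.
have sX : size X = L by case/andP: CV => /eqP.
have ltX : size (pre a X) < L by rewrite -sX; case/andP: CV => _ /lt.
have pre_ext : pre a (ext (pre a Y)) = pre a Y.
  by rewrite pre_cat pre_all /= ltnn cats0.
rewrite (tailA _ _ BCV extP) // /Y.
have preP i : i < L -> size (pre a (probe i)) = i.
  move=> iL; rewrite pre_cat all_nseq a0 orbT size_cat size_nseq.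
  by case: (L - i) => [|m] /=; rewrite ?ltnn addn0.
rewrite (homB X (probe (size (pre a X)))) ?preP //; last first.
  by rewrite size_cat !size_nseq subnKC // ltnW.
apply/eqP; rewrite -/(g _).
(* The letter of [X] ending the prefix is not a constant, so it does not come from a [0] of
   [select]; its place is marked in [s]. *)
have : nth false s (size (pre a X)).
  apply: (@nth_select a n); have : a <= nth 0 X (size (pre a X)) by apply: nth_size_pre; rewrite sX.
  rewrite (nth_map 0) ?size_select ?size_map ?size_iota // => le.
  case: posnP => // e; move: le; rewrite e /sub a0; lia.
by rewrite (nth_map 0) ?size_iota // nth_iota.
Qed.

(** * Rigidity in terms of first occurrences *)

Lemma rg_first a w b i j : rg a w b -> i < size w -> a <= j -> j < nth 0 w i ->
  exists2 i', i' < i & nth 0 w i' = j.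
Proof.
elim: w a i => [|c w IH] a [|i] //=.
  by case: (ltnP c a) => ca; [lia | case/andP=> /eqP->; lia].
case: (ltnP c a) => ca.
  by move=> r iw aj /(IH _ _ r iw aj)[i' lt e]; exists i'.+1.
case/andP=> /eqP-> r iw; rewrite leq_eqVlt => /orP[/eqP<-|aj]; first by exists 0.
by move=> /(IH _ _ r iw aj)[i' lt e]; exists i'.+1.
Qed.

Lemma rg_intro a w b : a <= b ->
  (forall i, i < size w -> nth 0 w i < b) ->
  (forall i j, i < size w -> a <= j -> j < nth 0 w i -> exists2 i', i' < i & nth 0 w i' = j) ->
  (forall j, a <= j -> j < b -> j \in w) -> rg a w b.
Proof.
elim: w a => [|c w IH] a ab lt first mem /=.
  by case: (ltngtP a b) ab => // /mem; rewrite leqnn => /(_ isT).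
have lt' i : i < size w -> nth 0 w i < b by apply: (lt i.+1).
case: (ltnP c a) => ca.
  apply: IH => // [i j iw aj jw|j aj jb].
    have [[|i'] i'i e] := first i.+1 j iw aj jw; last by exists i'.
    by rewrite /= in e; lia.
  by have := mem j aj jb; rewrite inE => /orP[/eqP|//]; lia.
have ca' : c = a.
  apply/eqP; rewrite eqn_leq ca andbT leqNgt; apply/negP => ac.
  by have [] := first 0 a isT (leqnn a) ac.
have cb : c < b by apply: (lt 0).
rewrite ca' eqxx /=; apply: IH => // [|i j iw aj jw|j aj jb]; first by rewrite -ca'.
  have [[|i'] i'i e] := first i.+1 j iw (ltnW aj) jw; last by exists i'.
  by rewrite /= in e; lia.
by have := mem j (ltnW aj) jb; rewrite inE => /orP[/eqP|//]; lia.
Qed.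

(** * Finite linear orders *)

(** Sorting by splitting at a pivot [a]. Positions with an arbitrary default stand in for boolean
    membership, so that the lemma serves points, functions and reals alike. *)
Lemma sorted_enumeration (T : Type) (lt : T -> T -> Prop) (l : seq T) :
  (forall x y z, lt x y -> lt y z -> lt x z) -> (forall x y, x <> y -> lt x y \/ lt y x) ->
  forall P : T -> Prop, (forall x, P x -> List.In x l) ->
  exists s : seq T, (forall x0 i j, i < j -> j < size s -> lt (nth x0 s i) (nth x0 s j)) /\
    forall x, P x <-> exists2 i, i < size s & forall x0, nth x0 s i = x.
Proof.
move=> trans total; elim: l => [|a l IH] P Pl.
  by exists [::]; split=> // x; split=> [/Pl|[]].
have [Pa|nPa] := pselect (P a); last first.
  by apply: IH => x Px; case: (Pl x Px) => // e; rewrite -e in Px.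
have [|s1 [lt1 P1]] := IH (fun x => P x /\ x <> a /\ lt x a).
  by move=> x [/Pl[e|//] [ne _]]; rewrite e in ne.
have [|s2 [lt2 P2]] := IH (fun x => P x /\ x <> a /\ lt a x).
  by move=> x [/Pl[e|//] [ne _]]; rewrite e in ne.
have nth1 x0 i : i < size s1 -> lt (nth x0 s1 i) a.
  by move=> is1; have [|_ []] := (P1 (nth x0 s1 i)).2;
    first by exists i => // x1; apply: set_nth_default.
have nth2 x0 i : i < size s2 -> lt a (nth x0 s2 i).
  by move=> is2; have [|_ []] := (P2 (nth x0 s2 i)).2;
    first by exists i => // x1; apply: set_nth_default.
exists (s1 ++ a :: s2); split=> [x0 i j ij|x].
  rewrite size_cat /= !nth_cat => js.
  case: (ltnP i (size s1)) => is1; case: (ltnP j (size s1)) => js1.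
  - exact: lt1.
  - case e: (j - size s1) => [|j'] /=; first exact: nth1.
    by apply: trans (nth1 x0 i is1) _; apply: nth2; lia.
  - by lia.
  - case ei: (i - size s1) => [|i']; case ej: (j - size s1) => [|j'] /=; try lia.
      by apply: nth2; lia.
    by apply: lt2; lia.
split=> [Px|[i]].
  have [->|ne] := pselect (x = a).
    by exists (size s1) => [|x0]; rewrite ?size_cat ?nth_cat ?ltnn ?subnn //=; lia.
  case: (total _ _ ne) => lx.
    have [i is1 e] := (P1 x).1 (conj Px (conj ne lx)).
    by exists i => [|x0]; rewrite ?size_cat ?nth_cat ?is1 //=; lia.
  have [i is2 e] := (P2 x).1 (conj Px (conj ne lx)).
  exists (size s1 + i.+1) => [|x0]; rewrite ?size_cat ?nth_cat //=; first by lia.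
  by rewrite ifN ?addKn //=; lia.
rewrite size_cat => ilt e.
have : x = nth x (s1 ++ a :: s2) i by rewrite e.
rewrite nth_cat; case: (ltnP i (size s1)) => is1.
  move=> ->; suff [] : P (nth x s1 i) /\ nth x s1 i <> a /\ lt (nth x s1 i) a by [].
  by apply/P1; exists i => // x1; apply: set_nth_default.
case ei: (i - size s1) => [|i'] /=; first by move=> ->.
move=> ->; suff [] : P (nth x s2 i') /\ nth x s2 i' <> a /\ lt a (nth x s2 i') by [].
by rewrite /= in ilt; apply/P2; exists i' => [|x1]; [lia | apply: set_nth_default; lia].
Qed.

Lemma ord_least m (P : 'I_m -> Prop) : (exists i, P i) ->
  exists i, P i /\ forall j, P j -> i <= j.
Proof.
case=> i0 /asboolP Pi0.
case: (@arg_minnP _ i0 (fun i => `[< P i >]) val Pi0) => i /asboolP Pi min.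
by exists i; split=> // j /asboolP /min.
Qed.

Lemma mem_In (T : eqType) (s : seq T) x : x \in s -> List.In x s.
Proof. by elim: s => //= y s IH; rewrite inE => /orP[/eqP->|/IH]; [left | right]. Qed.

Lemma index_nth_leq (w : seq nat) i : index (nth 0 w i) w <= i.
Proof. by rewrite leqNgt; apply/negP => /(before_find 0) /=; rewrite eqxx. Qed.

(** * The colexicographic order on subsets *)

Section Colex.
Variables (T : finType) (rank : T -> nat).
Hypothesis rank_inj : injective rank.

Definition colex (D E : pred T) : Prop :=
  exists p, [/\ E p, ~~ D p & forall p', rank p < rank p' -> D p' = E p'].

Lemma colex_irr D : ~ colex D D.
Proof. by case=> p [-> ]. Qed.

Lemma colex_trans D E F : colex D E -> colex E F -> colex D F.
Proof.
case=> p [Ep Dp DE] [p' [Fp' Ep' EF]].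
case: (ltngtP (rank p) (rank p')) => [lt|lt|/rank_inj e]; last by rewrite e (negbTE Ep') in Ep.
  by exists p'; split=> // [|r lr]; [rewrite DE | rewrite DE ?EF //; exact: ltn_trans lr].
by exists p; split=> // [|r lr]; [rewrite -EF | rewrite DE ?EF //; exact: ltn_trans lr].
Qed.

Lemma colex_total (D E : pred T) : (exists p, D p != E p) -> colex D E \/ colex E D.
Proof.
case=> p0 neq0.
case: (@arg_maxnP _ p0 (fun p => D p != E p) rank neq0) => p neq max.
have agree p' : rank p < rank p' -> D p' = E p'.
  by move=> lt; apply/eqP/negPn/negP => /max /(leq_trans lt); rewrite ltnn.
case Dp: (D p) neq; case Ep: (E p) => // _; [right | left]; exists p; split=> //.
- by rewrite Ep.
- by move=> p' /agree.
- by rewrite Dp.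
Qed.

(** The largest point of difference is [p] or lies above [p], and in both cases it belongs to
    [E]. *)
Lemma colex_of_above (D E : pred T) p : E p -> ~~ D p ->
  (forall p', rank p < rank p' -> D p' -> E p') -> colex D E.
Proof.
move=> Ep Dp incl; have [|//|[p' [Dp' Ep' ED]]] := @colex_total D E.
  by exists p; rewrite Ep (negbTE Dp).
case: (ltngtP (rank p) (rank p')) => [lt|lt|/rank_inj e].
- by rewrite (incl _ lt Dp') in Ep'.
- by rewrite (ED _ lt) (negbTE Dp) in Ep.
- by rewrite e Dp' in Dp.
Qed.

End Colex.

(** * Words over a scale as a metric space *)

Section Scale.
Variables (q : nat) (lv : 'I_q.+1 -> R).

Definition scale : Prop :=
  [/\ forall i j : 'I_q.+1, i < j -> (lv i < lv j)%R, lv ord0 = 0%R &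
      forall i j, (lv i + lv j <= lv ord_max)%R -> exists l, lv l = (lv i + lv j)%R].

Hypothesis sc : scale.

Lemma scale_lt i j : (lv i < lv j)%R <-> i < j.
Proof.
case: sc => inc _ _; split=> [lt|]; last exact: inc.
by case: (ltngtP i j) => // [/inc|/val_inj e]; [lra | rewrite e in lt; lra].
Qed.

Lemma scale_le i j : (lv i <= lv j)%R <-> i <= j.
Proof.
split=> [le|]; first by case: (leqP i j) => // /scale_lt; lra.
by rewrite leq_eqVlt => /orP[/eqP/val_inj->|/scale_lt]; lra.
Qed.

Lemma scale_inj : injective lv.
Proof.
move=> i j e; apply: val_inj; apply/eqP; rewrite eqn_leq.
by apply/andP; split; apply/scale_le; lra.
Qed.

Lemma scale_ge0 i : (0 <= lv i)%R.
Proof. by case: sc => _ <- _; apply/scale_le. Qed.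

Lemma scale_max i : (lv i <= lv ord_max)%R.
Proof. by apply/scale_le; rewrite -ltnS ltn_ord. Qed.

(** [lv l] is the sum truncated at the largest level. It bounds every real that is below both the
    sum and that level, which gives the triangle inequality for rounded distances. *)
Lemma scale_add i j : exists l, (lv l <= lv i + lv j)%R /\
  forall r, (r <= lv i + lv j -> r <= lv ord_max -> r <= lv l)%R.
Proof.
case: (Rle_dec (lv i + lv j) (lv ord_max)) => h.
  by case: sc => _ _ /(_ _ _ h)[l e]; exists l; split=> [|r]; lra.
by exists ord_max; split=> [|r]; lra.
Qed.

Lemma scale_diff i j : (Rabs (lv i - lv j) <= lv ord_max)%R.
Proof.
apply: Rabs_le; have := scale_ge0 i; have := scale_ge0 j.
have := scale_max i; have := scale_max j; lra.
Qed.

Lemma sup_dist_ex (N : nat) (v w : {ffun 'I_N -> 'I_q.+1}) :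
  exists s, (forall i, (Rabs (lv (v i) - lv (w i)) <= lv s)%R) /\
    forall s', (forall i, (Rabs (lv (v i) - lv (w i)) <= lv s')%R) -> s <= s'.
Proof.
apply: ord_least; by exists ord_max => i; apply: scale_diff.
Qed.

Definition sup_dist N (v w : {ffun 'I_N -> 'I_q.+1}) : 'I_q.+1 :=
  sval (cid (sup_dist_ex v w)).

Lemma sup_dist_bound N (v w : {ffun 'I_N -> 'I_q.+1}) i :
  (Rabs (lv (v i) - lv (w i)) <= lv (sup_dist v w))%R.
Proof. by rewrite /sup_dist; case: cid => s [/= h _]. Qed.

Lemma sup_dist_least N (v w : {ffun 'I_N -> 'I_q.+1}) s :
  (forall i, (Rabs (lv (v i) - lv (w i)) <= lv s)%R) -> sup_dist v w <= s.
Proof. by rewrite /sup_dist; case: cid => s' [/= _]; apply. Qed.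

(** The larger value comes first because the least function separating [x] from a later point is
    positive at [x] and zero at that point. *)
Definition revlex N (v w : {ffun 'I_N -> 'I_q.+1}) : Prop :=
  exists2 i, w i < v i & forall j : 'I_N, j < i -> v j = w j.

Lemma revlex_trans N (u v w : {ffun 'I_N -> 'I_q.+1}) :
  revlex u v -> revlex v w -> revlex u w.
Proof.
case=> i lt eq [i' lt' eq']; case: (ltngtP i i') => [h|h|/val_inj e].
- by exists i; [rewrite -eq' | move=> j ji; rewrite eq // eq' //; exact: ltn_trans h].
- by exists i'; [rewrite eq | move=> j ji; rewrite eq ?eq' //; exact: ltn_trans h].
- subst i'; exists i; first exact: ltn_trans lt.
  by move=> j ji; rewrite eq ?eq'.
Qed.

Lemma revlex_total N (v w : {ffun 'I_N -> 'I_q.+1}) : v <> w -> revlex v w \/ revlex w v.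
Proof.
move=> ne; have [|i [/eqP neq min]] := @ord_least N (fun i => v i <> w i).
  by apply: contra_notP ne => /forallNP h; apply/ffunP => i; apply: contrapT (h i).
have agree (j : 'I_N) : j < i -> v j = w j.
  by move=> ji; apply: contrapT => /min; rewrite leqNgt ji.
case: (ltngtP (v i) (w i)) neq => [lt _|lt _|/val_inj->]; last by rewrite eqxx.
  by right; exists i => // j /agree.
by left; exists i.
Qed.

Definition power_space (N : nat) : LOMS.
Proof.
refine (@Build_LOMS {ffun 'I_N -> 'I_q.+1} _ (fun v w => lv (sup_dist v w)) (@revlex N)
  _ _ _ _ (@revlex_trans N) (@revlex_total N)).
- by exists (enum {ffun 'I_N -> 'I_q.+1}) => v; apply: mem_In; rewrite mem_enum.
- move=> v w; split=> [e|->].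
    apply/ffunP => i; suff : lv (v i) = lv (w i) by apply: scale_inj.
    have := sup_dist_bound v w i.
    by rewrite e /Rabs; case: Rcase_abs => ? ?; lra.
  have : sup_dist w w <= (ord0 : 'I_q.+1).
    apply: sup_dist_least => i; case: sc => _ -> _.
    by rewrite Rminus_diag Rabs_R0; lra.
  by move/scale_le; case: sc => _ -> _; have := scale_ge0 (sup_dist w w); lra.
- move=> v w; apply: Rle_antisym; apply/scale_le; apply: sup_dist_least => i;
    rewrite Rabs_minus_sym; exact: sup_dist_bound.
- move=> u v w; have [l [le max]] := scale_add (sup_dist u v) (sup_dist v w).
  apply: Rle_trans le; apply/scale_le; apply: sup_dist_least => i.
  apply: max (scale_diff _ _).
  apply: Rle_trans (Rplus_le_compat _ _ _ _ (sup_dist_bound u v i) (sup_dist_bound v w i)).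
  have -> : (lv (u i) - lv (w i) = (lv (u i) - lv (v i)) + (lv (v i) - lv (w i)))%R by lra.
  exact: Rabs_triang.
- by move=> v [i]; rewrite ltnn.
Defined.

(** * Lipschitz functions *)

Definition metric n (d : 'I_n -> 'I_n -> R) : Prop :=
  [/\ forall x y, d x y = 0%R <-> x = y, forall x y, d x y = d y x,
      forall x y z, (d x z <= d x y + d y z)%R & forall x y, exists s, lv s = d x y].

Definition lip n (d : 'I_n -> 'I_n -> R) (f : {ffun 'I_n -> 'I_q.+1}) : Prop :=
  forall x y, (lv (f y) <= lv (f x) + d x y)%R.

Definition rank n (p : 'I_q.+1 * 'I_n) : nat := p.1 * n + p.2.

Definition hypograph n (f : {ffun 'I_n -> 'I_q.+1}) : pred ('I_q.+1 * 'I_n) :=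
  fun p => p.1 <= f p.2.

Definition flt n (f g : {ffun 'I_n -> 'I_q.+1}) : Prop :=
  colex (@rank n) (hypograph f) (hypograph g).

Lemma rank_ltP n (p p' : 'I_q.+1 * 'I_n) :
  rank p < rank p' <-> p.1 < p'.1 \/ p.1 = p'.1 /\ p.2 < p'.2.
Proof.
case: p p' => [w y] [w' y']; rewrite /rank /=; have := ltn_ord y; have := ltn_ord y'.
case: (ltngtP w w') => [lt|lt|/val_inj <-] ly' ly.
- by split=> [_|_]; [left | nia].
- by split=> [|[//|[e]]]; [nia | rewrite e ltnn in lt].
- by rewrite ltn_add2l; split=> [|[//|[]]]; [right | ].
Qed.

Lemma rank_inj n : injective (@rank n).
Proof.
move=> [w y] [w' y'] e.
have : ~ (rank (w, y) < rank (w', y')) /\ ~ (rank (w', y') < rank (w, y)) by rewrite e ltnn.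
rewrite !rank_ltP /= => -[n1 n2].
case: (ltngtP w w') => [lt|lt|/val_inj ew]; [by case: n1; left | by case: n2; left | subst w'].
case: (ltngtP y y') => [lt|lt|/val_inj-> //]; [by case: n1; right | by case: n2; right].
Qed.

Lemma flt_total n (f g : {ffun 'I_n -> 'I_q.+1}) : f <> g -> flt f g \/ flt g f.
Proof.
move=> ne; apply: colex_total.
have [x neq] : exists x, f x <> g x.
  by apply: contra_notP ne => /forallNP h; apply/ffunP => i; apply: contrapT (h i).
case: (ltngtP (f x) (g x)) => [lt|lt|/val_inj //].
  by exists (g x, x); rewrite /hypograph /= leqnn leqNgt lt.
by exists (f x, x); rewrite /hypograph /= leqnn leqNgt lt.
Qed.

Definition zerof n : {ffun 'I_n -> 'I_q.+1} := [ffun=> ord0].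

Definition lip_list n d (s : seq {ffun 'I_n -> 'I_q.+1}) : Prop :=
  (forall i j, i < j -> j < size s -> flt (nth (zerof n) s i) (nth (zerof n) s j)) /\
  forall f, lip d f <-> f \in s.

Lemma lip_list_ex n (d : 'I_n -> 'I_n -> R) : exists s, lip_list d s.
Proof.
have [|s [srt mem]] := @sorted_enumeration _ (@flt n) (enum {ffun 'I_n -> 'I_q.+1})
  (fun f g h => @colex_trans _ _ (@rank_inj n) _ _ _) (@flt_total n) (lip d).
  by move=> f _; apply: mem_In; rewrite mem_enum.
exists s; split=> [i j|f]; first exact: srt.
rewrite mem; split=> [[i lt e]|fs]; first by rewrite -(e (zerof n)) mem_nth.
by exists (index f s) => [|x0]; rewrite ?index_mem ?nth_index.
Qed.

Lemma lip_list_lt n (d : 'I_n -> 'I_n -> R) s i j : lip_list d s -> i < size s -> j < size s ->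
  flt (nth (zerof n) s i) (nth (zerof n) s j) -> i < j.
Proof.
case=> srt _ is_ js lt; case: (ltngtP i j) => // [ji|e].
  by case: (colex_irr (colex_trans (@rank_inj n) lt (srt _ _ ji is_))).
by rewrite e in lt; case: (colex_irr lt).
Qed.

Lemma lip_list_uniq n (d : 'I_n -> 'I_n -> R) s : lip_list d s -> uniq s.
Proof.
case=> srt _; apply/(uniqP (zerof n)) => i j; rewrite !inE => is_ js e.
case: (ltngtP i j) => // h.
  by have := srt _ _ h js; rewrite e => /colex_irr.
by have := srt _ _ h is_; rewrite e => /colex_irr.
Qed.

(** * Restriction and least extension of Lipschitz functions *)

Section Restriction.
Variables (nA nB : nat) (dA : 'I_nA -> 'I_nA -> R) (dB : 'I_nB -> 'I_nB -> R).
Hypotheses (mA : metric dA) (mB : metric dB).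
Variable u : 'I_nA -> 'I_nB.
Hypotheses (u_iso : forall x y, dB (u x) (u y) = dA x y) 
  (u_mono : forall x y : 'I_nA, x < y -> u x < u y).

Definition restrict (f : {ffun 'I_nB -> 'I_q.+1}) : {ffun 'I_nA -> 'I_q.+1} := [ffun x => f (u x)].

Lemma lip_restrict f : lip dB f -> lip dA (restrict f).
Proof. by move=> lf x y; rewrite !ffunE -u_iso. Qed.

Lemma metric_ge0 n (d : 'I_n -> 'I_n -> R) x y : metric d -> (0 <= d x y)%R.
Proof. by case=> _ _ _ /(_ x y)[s <-]; apply: scale_ge0. Qed.

(** A McShane extension: [h y] is the supremum of [g a - d (u a, y)] over all [a], rounded up to the
    scale. *)
Lemma lip_extension g : lip dA g -> exists h, [/\ lip dB h, restrict h = g &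
  forall y s, (forall a, (lv (g a) <= lv s + dB (u a) y)%R) -> h y <= s].
Proof.
move=> lg.
have ex y : exists s, (forall a, (lv (g a) <= lv s + dB (u a) y)%R) /\
    forall s', (forall a, (lv (g a) <= lv s' + dB (u a) y)%R) -> s <= s'.
  apply: ord_least; exists ord_max => a.
  by have := scale_max (g a); have := metric_ge0 (u a) y mB; lra.
have [h hP] := fin_all_exists ex.
exists [ffun y => h y]; split=> [x y||y s]; last by rewrite ffunE; case: (hP y) => _; apply.
  rewrite !ffunE; case: mB => _ sym tri /(_ x y)[s es].
  (* The truncated sum of [h x] and [d x y] satisfies the condition that defines [h y] as a
     minimum. *)
  have [l [le max]] := scale_add (h x) s; rewrite -es.
  apply: Rle_trans le; apply/scale_le; case: (hP y) => _; apply => a.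
  case: (hP x) => /(_ a) hx _; have := tri (u a) y x; rewrite (sym y x) -es => t.
  have := max (lv (g a) - dB (u a) y)%R; have := scale_max (g a).
  have := metric_ge0 (u a) y mB; lra.
apply/ffunP => a; rewrite !ffunE; apply: val_inj; apply/eqP; rewrite eqn_leq.
case: (hP (u a)) => ge le; apply/andP; split.
  by apply: le => a'; rewrite u_iso; case: mA => _ sym _ _; rewrite sym; apply: lg.
suff /scale_le : (lv (g a) <= lv (h (u a)))%R by [].
have d0 : dB (u a) (u a) = 0%R by case: mB => zero _ _ _; apply/zero.
by have := ge a; rewrite d0; lra.
Qed.

(** Let [(v, a)] be the point deciding between [g'] and the restriction of [f]. Then [(v, u a)] lies
    under [f] and not under [h], and above it everything under [h] is under [f]. *)
Lemma extension_flt f g' h : lip dB f -> restrict h = g' -> flt g' (restrict f) ->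
  (forall y s, (forall a, (lv (g' a) <= lv s + dB (u a) y)%R) -> h y <= s) -> flt h f.
Proof.
move=> lf hg' [[v a] [vg vg' agree]] least.
rewrite /hypograph /= in vg vg'.
apply: (@colex_of_above _ _ (@rank_inj nB) _ _ (v, u a)); rewrite /hypograph /=.
- by move: vg; rewrite ffunE.
- by move: vg'; rewrite -hg' ffunE.
move=> [w y] /rank_ltP /= lt wh; rewrite leqNgt; apply/negP => fw.
(* [s0] is the level just below [w]; it exists because [f y < w]. *)
have [s0 [s0w max]] : exists s0 : 'I_q.+1, s0 < w /\ forall s : 'I_q.+1, s < w -> s <= s0.
  have sq : w.-1 < q.+1 by have := ltn_ord w; lia.
  by exists (Ordinal sq); split=> /= [|s]; lia.
suff : h y <= s0 by lia.
apply: least => a'.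
have := lf y (u a'); case: mB => zero sym _ spec; rewrite [dB y _]sym => lfa.
have fs0 : (lv (f y) <= lv s0)%R by apply/scale_le; exact: max.
(* Where [g'] does not exceed [f], the Lipschitz condition on [f] suffices. Elsewhere [(g' a', a')]
   cannot lie above the deciding point [(v, a)]. *)
case: (leqP (g' a') (restrict f a')) => [/scale_le|ltg]; first by rewrite ffunE; lra.
have : ~ rank (v, a) < rank (g' a', a').
  by move=> /agree; rewrite /hypograph /= leqnn leqNgt ltg.
rewrite rank_ltP /= => nlt.
have d0 := metric_ge0 (u a') y mB.
have gv : g' a' <= v by rewrite leqNgt; apply/negP => h1; apply: nlt; left.
have vw : v <= w by case: lt => [/ltnW|[->]].
case: (ltnP (g' a') w) => gw; first by have /scale_le := max _ gw; lra.
have vE : v = g' a' by apply: val_inj => /=; lia.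
have wE : w = g' a' by apply: val_inj => /=; lia.
case: lt => [|[_ lty]]; first by rewrite vE wE ltnn.
(* In the remaining case all levels equal [w], so the points decide: [a'] is at most [a], and [u a]
   precedes [y]. The distance from [u a'] to [y] is then positive and lifts [s0] at least to the
   next level [w]. *)
have ne : u a' <> y.
  move=> e; apply: nlt; right; split=> //.
  case: (ltngtP a a') => // [/u_mono|/val_inj e']; first by rewrite e; lia.
  by rewrite -e -e' ltnn in lty.
case: (spec (u a') y) => s es.
have spos : (0 < lv s)%R.
  have := scale_ge0 s; have : lv s <> 0%R by rewrite es => /zero.
  lra.
have [l [le maxl]] := scale_add s0 s.
suff /scale_le : g' a' <= l by lra.
rewrite leqNgt -wE; apply/negP => /max /scale_le.
have /scale_lt := s0w; have := scale_max w.
have := maxl (lv s0 + lv s)%R; have := maxl (lv ord_max).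
by case: (Rle_dec (lv s0 + lv s) (lv ord_max)); lra.
Qed.

(** Every value occurs since every function extends. If the function numbered [j] precedes the
    restriction of [f], its least extension precedes [f], so the value [j] has occurred before. *)
Lemma pword_restrict sA sB : lip_list dA sA -> lip_list dB sB ->
  pword 0 (size sB) (size sA) [seq index (restrict f) sA | f <- sB].
Proof.
move=> lA lB; rewrite /pword size_map eqxx /= add0n.
have memA f : f \in sB -> restrict f \in sA.
  by move=> /lB.2 /lip_restrict /lA.2.
have nthE i : i < size sB -> nth 0 [seq index (restrict f) sA | f <- sB] i =
    index (restrict (nth (zerof nB) sB i)) sA.
  by move=> iB; rewrite (nth_map (zerof nB)).
have ext j : j < size sA -> exists h, [/\ h \in sB, restrict h = nth (zerof nA) sA j &
    forall y s, (forall a, (lv (nth (zerof nA) sA j a) <= lv s + dB (u a) y)%R) -> h y <= s].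
  by move=> /(mem_nth (zerof nA)) /lA.2 /lip_extension[h [/lB.2 hB rh least]]; exists h.
apply: rg_intro => //; rewrite ?size_map.
- by move=> i iB; rewrite nthE // index_mem memA // mem_nth.
- move=> i j iB _; rewrite nthE //; set f := nth _ sB i => ji.
  have fB : f \in sB by apply: mem_nth.
  have fA : index (restrict f) sA < size sA by rewrite index_mem memA.
  have jA := ltn_trans ji fA; have [h [hB rh least]] := ext _ jA.
  have hf : flt h f.
    apply: extension_flt rh _ least; first exact/lB.2.
    by rewrite -[restrict f](nth_index (zerof nA) (memA _ fB)); apply: lA.1.
  have hi : index h sB < size sB by rewrite index_mem.
  exists (index h sB); last by rewrite nthE // nth_index // rh index_uniq // (lip_list_uniq lA).
  by apply: (lip_list_lt lB) => //; rewrite nth_index.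
- move=> j _ /[dup] jA /ext[h [hB rh _]]; apply/mapP; exists h => //.
  by rewrite rh index_uniq // (lip_list_uniq lA).
Qed.

End Restriction.

(** * Kuratowski-type embeddings along a word *)

Definition word_map n N (s : seq {ffun 'I_n -> 'I_q.+1}) (w : seq nat) (x : 'I_n) :
    {ffun 'I_N -> 'I_q.+1} :=
  [ffun i : 'I_N => nth (zerof n) s (nth 0 w i) x].

Section WordMap.
Variables (n : nat) (d : 'I_n -> 'I_n -> R) (s : seq {ffun 'I_n -> 'I_q.+1}).
Variables (N : nat) (w : seq nat).
Hypotheses (md : metric d) (ls : lip_list d s) (wP : pword 0 N (size s) w).

Lemma word_map_nth i : i < N -> nth 0 w i < size s.
Proof. by case/andP: wP => /eqP sw rw iN; apply: (rg_lt rw); rewrite mem_nth ?sw. Qed.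

(** Each coordinate is Lipschitz, which bounds the distance above; the function [d x] is itself on
    the list and occurs in [w], so the bound is attained. *)
Lemma word_map_dist x y : lv (sup_dist (word_map N s w x) (word_map N s w y)) = d x y.
Proof.
case: (md) => zero sym tri spec; have [t et] := spec x y.
rewrite -et; apply: Rle_antisym; apply/scale_le.
  apply: sup_dist_least => i; rewrite !ffunE et.
  have /ls.2 lf : nth (zerof n) s (nth 0 w i) \in s by rewrite mem_nth // word_map_nth.
  by apply: Rabs_le; have := lf x y; have := lf y x; rewrite (sym y x); lra.
have [k kP] := fin_all_exists (spec x).
have kE z : [ffun z => k z] z = k z by rewrite ffunE.
have kL : [ffun z => k z] \in s.
  by apply/ls.2 => z z'; rewrite !kE !kP.
have kw : index [ffun z => k z] s \in w.
  by case/andP: wP => _ rw; apply: (rg_mem rw); rewrite ?add0n ?index_mem.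
have iN : index (index [ffun z => k z] s) w < N.
  by case/andP: wP => /eqP <- _; rewrite index_mem.
have := sup_dist_bound (word_map N s w x) (word_map N s w y) (Ordinal iN).
rewrite !ffunE /= nth_index // nth_index // !kE !kP -et.
have -> : d x x = 0%R by apply/zero.
have := scale_ge0 t; move=> t0; rewrite Rminus_0_l Rabs_Ropp Rabs_pos_eq // => h.
by apply/scale_le.
Qed.

(* The least Lipschitz function separating [x] from a later point is the one
   which is the first positive scale element at [x] and [0] elsewhere. *)
Lemma word_map_mono (x y : 'I_n) : x < y -> revlex (word_map N s w x) (word_map N s w y).
Proof.
move=> xy; case: (md) => zero sym tri spec.
have pos z z' : z <> z' -> exists2 t : 'I_q.+1, 0 < t & lv t = d z z'.
  move=> ne; have [t et] := spec z z'; exists t => //; rewrite lt0n; apply/negP => /eqP t0.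
  apply/ne/zero; rewrite -et; case: sc => _ <- _; congr lv; exact: val_inj.
have nxy : x <> y by move=> e; rewrite e ltnn in xy.
have [t t0 _] := pos _ _ nxy.
have q1 : 1 < q.+1 by apply: leq_ltn_trans t0 (ltn_ord t).
pose f0 : {ffun 'I_n -> 'I_q.+1} := [ffun z => if z == x then Ordinal q1 else ord0].
have f0L : f0 \in s.
  apply/ls.2 => z z'; rewrite !ffunE; have d0 := metric_ge0 z z' md.
  have o0 := scale_ge0 (Ordinal q1); have lv0 : lv ord0 = 0%R by case: sc.
  case: (altP (z' =P x)) => [e'|_]; case: (altP (z =P x)) => [e|/eqP ne]; rewrite ?lv0; try lra.
  have [|t' t'0 <-] := pos z z'; first by rewrite e'.
  have : (lv (Ordinal q1) <= lv t')%R by apply/scale_le.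
  lra.
(* A function before [f0] vanishes at [x]. As [(1, y)] ranks above [(1, x)], it agrees there with
   [f0] and vanishes at [y] too. *)
have before f : flt f f0 -> f x = f y.
  case=> -[v z] [/= vf0 vf agree]; rewrite /hypograph /= in vf0 vf.
  move: vf0 vf; rewrite ffunE; case: (altP (z =P x)) => [zx|_] /=; last by lia.
  rewrite {}zx in agree *.
  move=> v1 fv; have v1E : v = Ordinal q1 by apply: val_inj => /=; lia.
  have := agree (Ordinal q1, y); rewrite rank_ltP v1E /= => /(_ (or_intror (conj erefl xy))).
  rewrite /hypograph /= ffunE ifN /=; last by apply/eqP => e; apply: nxy.
  by move=> fy; apply: val_inj => /=; lia.
case/andP: (wP) => /eqP sw rw; rewrite add0n in rw.
have jw : index f0 s \in w by apply: (rg_mem rw); rewrite ?index_mem.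
have iN : index (index f0 s) w < N by rewrite -sw index_mem.
exists (Ordinal iN).
  rewrite !ffunE /= nth_index // nth_index // !ffunE eqxx ifN //.
  by apply/eqP => e; apply: nxy.
move=> i /= ii; rewrite !ffunE; apply: before.
rewrite -[f0](nth_index (zerof n) f0L); apply: ls.1; last by rewrite index_mem.
(* By rigidity, all letters before the first occurrence of the index of [f0] are smaller than that
   index. *)
rewrite ltnNge; apply/negP; rewrite leq_eqVlt => /orP[/eqP e|lt].
  by have := index_nth_leq w i; rewrite -e leqNgt ii.
have [i' i'i e] := rg_first rw (ltac:(by rewrite sw) : i < size w) (leq0n _) lt.
by have := index_nth_leq w i'; rewrite e; lia.
Qed.

End WordMap.
End Scale.

(** The value of [f] at [u x] is the value of its restriction at [x], so an embedding of points
    turns into a substitution of words. *)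
Lemma word_map_comp q (lv : 'I_q.+1 -> R) nA nB (dA : 'I_nA -> 'I_nA -> R)
    (dB : 'I_nB -> 'I_nB -> R) (u : 'I_nA -> 'I_nB) sA sB N W x :
  (forall x y, dB (u x) (u y) = dA x y) -> lip_list lv dA sA -> lip_list lv dB sB ->
  pword 0 N (size sB) W ->
  word_map N sB W (u x) = word_map N sA (comp 0 W [seq index (restrict u f) sA | f <- sB]) x.
Proof.
move=> iso lA lB WP; apply/ffunP => i; rewrite !ffunE.
have lt := word_map_nth WP (ltn_ord i).
have iW : i < size W by case/andP: WP => /eqP -> _.
rewrite /comp (nth_map 0) // /sub ltn0 subn0 (nth_map (zerof q nB)) // nth_index ?ffunE //.
by apply/lA.2; apply: (lip_restrict iso); apply/lB.2; rewrite mem_nth.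
Qed.

(** * Embedding metric spaces *)

Lemma points_enum (M : LOMS) : exists n (sigma : 'I_n -> pt M) (tau : pt M -> 'I_n),
  [/\ cancel tau sigma, cancel sigma tau & forall i j : 'I_n, i < j -> olt M (sigma i) (sigma j)].
Proof.
have [l full] := pt_finite M.
have [|s [srt mem]] :=
    sorted_enumeration (@olt_trans M) (@olt_total M) (P := fun _ => True) (l := l).
  by move=> x _; apply: full.
pose sigma := tnth (in_tuple s).
have mono (i j : 'I_(size s)) : i < j -> olt M (sigma i) (sigma j).
  by move=> ij; rewrite /sigma !(tnth_nth (sigma i)); apply: srt => //; apply: ltn_ord.
have surj x : exists i, sigma i = x.
  have [i ilt e] := (mem x).1 Logic.I; exists (Ordinal ilt).
  by rewrite /sigma (tnth_nth x) /= e.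
have [tau tauK] := choice surj.
exists (size s), sigma, tau; split=> // i.
have e := tauK (sigma i); case: (ltngtP (tau (sigma i)) i) => [/mono|/mono|/val_inj //].
  by rewrite e => /olt_irrefl.
by rewrite e => /olt_irrefl.
Qed.

(** * The scale generated by finitely many distances *)

Definition sumR (ts : seq R) : R := foldr Rplus 0%R ts.

Fixpoint sums (T : seq R) (n : nat) : seq R :=
  if n is n'.+1 then
    sums T n' ++ List.flat_map (fun t => List.map (Rplus t) (sums T n')) T
  else [:: 0%R].

Lemma sumR_in_sums T n ts : size ts <= n -> (forall t, List.In t ts -> List.In t T) ->
  List.In (sumR ts) (sums T n).
Proof.
elim: n ts => [|n IH] [|t ts] //= sz inT; first by left.
  by apply: List.in_or_app; left; apply: (IH [::]).
apply: List.in_or_app; right; apply/List.in_flat_map; exists t.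
split; first by apply: inT; left.
by apply/List.in_map_iff; exists (sumR ts); split=> //; apply: IH => // x xt; apply: inT; right.
Qed.

Lemma sumR_ge_size t0 ts : (forall t, List.In t ts -> (t0 <= t)%R) ->
  (INR (size ts) * t0 <= sumR ts)%R.
Proof.
elim: ts => [|t ts IH] /= ge; first lra.
rewrite -/(INR (size ts).+1) S_INR.
have := ge t (or_introl erefl); have := IH (fun x h => ge x (or_intror h)); lra.
Qed.

Lemma sumR_cat ts ts' : sumR (ts ++ ts') = (sumR ts + sumR ts')%R.
Proof. by elim: ts => [|t ts IH] /=; rewrite ?IH; lra. Qed.

Lemma list_max0 (T : seq R) : exists m, [/\ (0 <= m)%R, m = 0%R \/ List.In m T &
  forall t, List.In t T -> (t <= m)%R].
Proof.
elim: T => [|t T [m [m0 mT max]]]; first by exists 0%R; split; [lra | left | ].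
case: (Rle_dec t m) => h.
  by exists m; split=> //= [|t' [<-|/max]] //; case: mT; auto.
by exists t; split=> /= [||t' [<-|/max]]; [lra | auto | lra | lra].
Qed.

Lemma list_min_pos (T : seq R) : exists2 t0, (0 < t0)%R &
  forall t, List.In t T -> (0 < t)%R -> (t0 <= t)%R.
Proof.
elim: T => [|t T [t0 p min]]; first by exists 1%R => //; lra.
case: (Rlt_dec 0 t) => h; last by exists t0 => //= t' [<-|/min].
exists (Rmin t t0); first exact: Rmin_glb_lt.
move=> t' /= [<- _|/min m /m le]; first exact: Rmin_l.
by apply: Rle_trans le; apply: Rmin_r.
Qed.

(* The scale consists of the sums of elements of [T] not exceeding [max T]. *)
Lemma scale_ex (A I : R -> Prop) (T : seq R) :
  is_subsemigroup_with_0 A -> is_interval I ->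
  (forall t, List.In t T -> (0 <= t)%R /\ (t = 0%R \/ (I t /\ A t))) ->
  exists q (lv : 'I_q.+1 -> R), [/\ scale lv, forall i, lv i = 0%R \/ (I (lv i) /\ A (lv i)) &
    forall t, List.In t T -> exists i, lv i = t].
Proof.
move=> [A0 Aadd] Iconv TS.
have [m [m0 mT mmax]] := list_max0 T; have [t0 t0p t0min] := list_min_pos T.
pose posT ts := forall t, List.In t ts -> List.In t T /\ (0 < t)%R.
pose P x := (x <= m)%R /\ exists2 ts, posT ts & x = sumR ts.
(* All terms are positive, hence at least [t0]; a sum not exceeding [m] has at most [n0] of them, so
   there are finitely many such sums. *)
have [n0 n0P] : exists n0, (m < INR n0 * t0)%R.
  have [n0 h] := INR_unbounded (m / t0); exists n0.
  have := Rmult_lt_compat_r _ _ _ t0p h; rewrite /Rdiv Rmult_assoc Rinv_l; lra.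
have ge ts : posT ts -> forall t, List.In t ts -> (t0 <= t)%R.
  by move=> pts t /pts[tT tp]; apply: t0min.
have [|s [srt mem]] := @sorted_enumeration R Rlt (sums T n0) Rlt_trans
    (fun x y => (Rdichotomy x y)) P.
  move=> x [le [ts pts xE]]; rewrite xE in le *; apply: sumR_in_sums => [|t /pts[]//].
  rewrite leqNgt; apply/negP => /ltP/lt_INR h; have := sumR_ge_size (ge _ pts).
  have := Rmult_lt_compat_r _ _ _ t0p h; lra.
have sum0 ts : posT ts -> (0 <= sumR ts)%R.
  move=> pts; have := sumR_ge_size (ge _ pts); have := pos_INR (size ts); nra.
have P0 : P 0%R by split=> //; exists [::].
have [i0 i0s i0E] := (mem 0%R).1 P0.
have sq : (size s).-1.+1 = size s by case: (size s) i0s.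
pose lv (i : 'I_(size s).-1.+1) := nth 0%R s i.
have lvP i : P (lv i).
  apply/mem; exists i => [|x0].
    by rewrite -[X in _ < X]sq.
  by apply: set_nth_default; rewrite -[X in _ < X]sq.
have lv_ex x : P x -> exists i, lv i = x.
  move=> /mem[i ilt e]; have ilt' : i < (size s).-1.+1 by rewrite sq.
  by exists (Ordinal ilt'); rewrite /lv /= e.
exists (size s).-1, lv; split.
- split=> [i j ij||i j le].
  + by apply: srt; rewrite // -[X in _ < X]sq.
  + case: (posnP i0) => [e|i0p]; first by rewrite /lv /= -e i0E.
    have := srt 0%R 0 i0 i0p i0s; rewrite i0E.
    by have [_ [ts /sum0 h e]] := lvP ord0; rewrite -/(lv ord0) e; lra.
  + apply: lv_ex; have [_ [ts pts e]] := lvP i; have [_ [ts' pts' e']] := lvP j.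
    split; first by have [h _] := lvP ord_max; lra.
    exists (ts ++ ts'); last by rewrite sumR_cat e e'.
    by move=> t /List.in_app_iff[/pts|/pts'].
- move=> i; have [le [ts pts e]] := lvP i; rewrite e in le *.
  case: ts pts {e} le => [|t ts] pts; first by left.
  have ptss : posT ts by move=> x xt; apply: pts; right.
  have [tT tp] := pts t (or_introl erefl).
  have AI x : List.In x T -> (0 < x)%R -> I x /\ A x.
    by move=> /TS[_ [->|//]]; lra.
  (* A nonempty sum lies between its first term and [m], both in [I], and convexity applies;
     membership in [A] follows from closure under addition. *)
  move=> le; right; split.
    have [tI _] := AI _ tT tp; have s0 := sum0 _ ptss.
    rewrite /= -/(sumR ts) in le *.
    case: mT => [mE|mT]; first lra.
    have [mI _] := AI m mT ltac:(lra).
    by apply: (Iconv t _ m) => //; lra.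
  suff A_sumR us : posT us -> A (sumR us) by exact: A_sumR.
  elim: us => [|x xs IH] px //=.
  apply: Aadd; last by apply: IH => y yx; apply: px; right.
  by have [xT xp] := px x (or_introl erefl); have [] := AI _ xT xp.
- move=> t tT; apply: lv_ex; split; first exact: mmax.
  have [t0' _] := TS _ tT; case: (Rle_lt_or_eq_dec _ _ t0') => [tp|<-]; last by exists [::].
  by exists [:: t]; [move=> x [<-|//] | rewrite /=; lra].
Qed.

Lemma dist_ge0 (M : LOMS) x y : (0 <= dist M x y)%R.
Proof.
have := dist_tri M x y x; rewrite (dist_sym M y x).
have -> : dist M x x = 0%R by apply/dist_zero.
lra.
Qed.

(** * Words as embeddings of ordered metric spaces *)

Section Realisation.
Variables (q : nat) (lv : 'I_q.+1 -> R) (sc : scale lv) (M : LOMS) (n N : nat).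
Variables (sigma : 'I_n -> pt M) (tau : pt M -> 'I_n).
Hypotheses (tauK : cancel tau sigma) (sigmaK : cancel sigma tau).
Hypothesis mono : forall i j : 'I_n, i < j -> olt M (sigma i) (sigma j).
Hypothesis spec : forall x y, exists s, lv s = dist M x y.

Let d i j := dist M (sigma i) (sigma j).

Lemma metric_pull : metric lv d.
Proof.
split=> [x y|x y|x y z|x y]; last exact: spec.
- by rewrite dist_zero; split=> [/(can_inj sigmaK)|->].
- exact: dist_sym.
- exact: dist_tri.
Qed.

Lemma word_map_emb s w : lip_list lv d s -> pword 0 N (size s) w ->
  is_emb M (power_space sc N) (fun x => word_map N s w (tau x)).
Proof.
move=> ls wP; have dE x y :
    dist (power_space sc N) (word_map N s w (tau x)) (word_map N s w (tau y)) = dist M x y.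
  by rewrite /= (word_map_dist sc metric_pull ls wP) /d !tauK.
split=> [x y e|]; first by apply/dist_zero; rewrite -dE e; apply/dist_zero.
split=> // x y.
have fwd x' y' : olt M x' y' -> revlex (word_map N s w (tau x')) (word_map N s w (tau y')).
  move=> lt; apply: (word_map_mono sc metric_pull ls wP).
  case: (ltngtP (tau x') (tau y')) => // [/mono|/val_inj/(can_inj tauK) e].
    by rewrite !tauK => lt'; case: (olt_irrefl M x'); apply: olt_trans lt lt'.
  by rewrite e in lt; case: (olt_irrefl _ _ lt).
split; first exact: fwd.
move=> lt; have [e|ne] := pselect (x = y).
  by rewrite e in lt; case: (olt_irrefl (power_space sc N) _ lt).
case: (olt_total _ _ _ ne) => // /fwd lt'.
by case: (olt_irrefl (power_space sc N) _ (olt_trans (power_space sc N) _ _ _ lt lt')).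
Qed.

End Realisation.

(** * The Ramsey property *)

Open Scope R_scope.

Theorem theorem4p4 (A I : R -> Prop) :
  is_subsemigroup_with_0 A -> is_interval I ->
  ramsey_property (fun r => r = 0 \/ (I r /\ A r)).
Proof.
move=> sgA intI k _ X Y sX sY [f0 f0E].
have [l full] := pt_finite Y.
have [|q [lv [sc lvS lvY]]] :=
    scale_ex (T := List.flat_map (fun x => List.map (dist Y x) l) l) sgA intI.
  move=> t /List.in_flat_map[x [_ /List.in_map_iff[y [<- _]]]].
  by split; [apply: dist_ge0 | apply: sY].
have specY x y : exists s, lv s = dist Y x y.
  by apply: lvY; apply/List.in_flat_map; exists x; split=> //; apply/List.in_map.
have specX x y : exists s, lv s = dist X x y.
  by case: f0E => _ [<- _].
have [nX [sigX [tauX [tauXK sigXK monoX]]]] := points_enum X.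
have [nY [sigY [tauY [tauYK sigYK monoY]]]] := points_enum Y.
pose dX i j := dist X (sigX i) (sigX j); pose dY i j := dist Y (sigY i) (sigY j).
have mX : metric lv dX by apply: metric_pull.
have mY : metric lv dY by apply: metric_pull.
have [lX lXP] := lip_list_ex lv dX; have [lY lYP] := lip_list_ex lv dY.
(* The alphabet is empty, so the words are rigid surjections. The colour type ['I_k.+1] is inhabited
   as [inord] requires, and [inord] is faithful on the colours below [k]. *)
have [N HN] := graham_rothschild (size lX) 0%nat (size lY) 'I_k.+1.
exists (power_space sc N); split=> [x y|chi chik]; first exact: lvS.
have [W WP monoW] := HN (fun w => inord (chi (fun x => word_map N lX w (tauX x)))).
pose w x := word_map N lY W (tauY x).
have wE : is_emb Y (power_space sc N) w by apply: word_map_emb WP.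
(* Each [u] gives a word [v] of restrictions, so [w] after [u] is the embedding of [X] along [W]
   with [v] substituted, which is what [monoW] controls. *)
have key u : is_emb X Y u -> exists2 v, pword 0%nat (size lY) (size lX) v &
    (fun x => w (u x)) = (fun x => word_map N lX (comp 0%nat W v) (tauX x)).
  case=> inj [iso ord]; pose u' i := tauY (u (sigX i)).
  have iso' i j : dY (u' i) (u' j) = dX i j by rewrite /dY /u' !tauYK iso.
  exists [seq index (restrict u' f) lX | f <- lY].
    apply: (pword_restrict sc mX mY iso') => // i j ij.
    have := (ord _ _).1 (monoX _ _ ij); rewrite /u' => lt.
    case: (ltngtP (tauY (u (sigX i))) (tauY (u (sigX j)))) => //
      [/monoY|/val_inj/(can_inj tauYK) e].
      by rewrite !tauYK => lt'; case: (olt_irrefl _ _ (olt_trans _ _ _ _ lt lt')).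
    by rewrite e in lt; case: (olt_irrefl _ _ lt).
  apply/funext => x; rewrite -(word_map_comp _ iso' lXP lYP WP) /w /u' tauXK //.
have [v0 v0P e0] := key _ f0E.
have embP v : pword 0%nat (size lY) (size lX) v ->
    (chi (fun x => word_map N lX (comp 0%nat W v) (tauX x)) < k)%nat.
  move=> vP; apply/ltP/chik; apply: word_map_emb => //; exact: pword_comp WP vP.
exists (chi (fun x => w (f0 x))), w; split; first by rewrite e0; apply/ltP/embP.
split=> // u /key[v vP ->]; rewrite e0.
have := congr1 (@nat_of_ord _) (monoW _ _ vP v0P).
by rewrite !inordK // ltnS ltnW // embP.
Qed.
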